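(* For all positive integers $r,n$, the following identity holds in $\mathbb{Z}[[z_0,\ldots,z_n]]$: \[ \sum_{ k \ge 0 } \prod_{ j=1 }^n [k+1]_{ z_j } \, z_0^k \ = \ \sum_{ (\pi,\epsilon)\in \mathbb{Z}_r\wr S_n } \frac{ \displaystyle \prod_{\substack{j\in \mathrm{Des}(\pi) \\ a_j^\epsilon=0 }}z_0^rz_{\pi(1)}^rz_{\pi(2)}^r\cdots z_{\pi(j)}^r \prod_{j=1}^nz_0^{a_j^\epsilon}z_{\pi(1)}^{a_j^\epsilon}z_{\pi(2)}^{a_j^\epsilon}\cdots z_{\pi(j)}^{a_j^\epsilon} }{ \displaystyle (1-z_0)\prod_{ j=1 }^n \left( 1 - z_0^r \, z_{\pi(1) }^{r} z_{\pi(2) }^{r} \cdots z_{\pi(j)}^{r} \right) } \, . \]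
   Context: $[m]_z=1+z+\cdots+z^{m-1}$. For $\pi\in S_n$, $\mathrm{Des}(\pi)=\{j\in[n-1]:\pi(j)>\pi(j+1)\}$. With $\omega=e^{2\pi i/r}$, the wreath product $\mathbb{Z}_r\wr S_n$ is the set of pairs $(\pi,\epsilon)$ with $\pi\in S_n$ and $\epsilon=(\omega^{c_1},\ldots,\omega^{c_n})$, $c_j\in\{0,\ldots,r-1\}$. Set $c_{n+1}:=0$ and define the color changes $a_j^\epsilon=(c_j-c_{j+1})\bmod r\in\{0,\ldots,r-1\}$ for $j\in[n]$. *)

(* Defs.v *)
From HB Require Import structures.
From mathcomp Require Import all_boot all_order all_algebra.
From mathcomp Require Import fingroup perm.
From mathcomp Require Import mpoly.
From mathcomp Require Import boolp.

Set Implicit Arguments.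
Unset Strict Implicit.
Unset Printing Implicit Defensive.

Import GRing.Theory.
Local Open Scope ring_scope.

(** * The ring R[[X_0, ..., X_(n-1)]] of formal power series

    A power series is the family of its coefficients, indexed by the exponent
    vectors 'X_{1..n} of the multinomials library; f m is the coefficient of
    the monomial with exponent vector m. *)
Record mfps (n : nat) (R : Type) := MFps { mfps_coef :> 'X_{1..n} -> R }.

HB.instance Definition _ (n : nat) (R : Type) := gen_eqMixin (mfps n R).
HB.instance Definition _ (n : nat) (R : Type) := gen_choiceMixin (mfps n R).

Lemma mfpsP (n : nat) (R : Type) (f g : mfps n R) : f =1 g -> f = g.
Proof. by case: f => f; case: g => g /= fg; congr MFps; apply/funext. Qed.

Section MfpsRing.
Variables (n : nat) (R : comNzRingType).
Implicit Types (f g h : mfps n R) (m : 'X_{1..n}).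

Definition mfps0 : mfps n R := MFps (fun=> 0).
Definition mfps1 : mfps n R := MFps (fun m => (m == 0%MM)%:R).
Definition mfps_add f g : mfps n R := MFps (fun m => f m + g m).
Definition mfps_opp f : mfps n R := MFps (fun m => - f m).
(* Cauchy product. The bound on the degrees of k.1 and k.2 is implied by the
   condition m = k.1 + k.2 and only makes the index type finite. *)
Definition mfps_mul f g : mfps n R := MFps (fun m =>
  \sum_(k : 'X_{1..n < (mdeg m).+1, (mdeg m).+1} | m == (k.1 + k.2)%MM)
    f k.1 * g k.2).

Fact mfps_addA : associative mfps_add.
Proof. by move=> f g h; apply: mfpsP => m /=; rewrite addrA. Qed.
Fact mfps_addC : commutative mfps_add.
Proof. by move=> f g; apply: mfpsP => m /=; rewrite addrC. Qed.
Fact mfps_add0 : left_id mfps0 mfps_add.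
Proof. by move=> f; apply: mfpsP => m /=; rewrite add0r. Qed.
Fact mfps_addN : left_inverse mfps0 mfps_opp mfps_add.
Proof. by move=> f; apply: mfpsP => m /=; rewrite addNr. Qed.

HB.instance Definition _ :=
  GRing.isZmodule.Build (mfps n R) mfps_addA mfps_addC mfps_add0 mfps_addN.

(* The ring axioms are transferred from {mpoly R[n]} by truncation. *)
Definition mfps_trunc d f : {mpoly R[n]} :=
  \sum_(k : 'X_{1..n < d.+1}) f k *: 'X_[k].

Lemma mcoeff_mfps_trunc d f m : (mdeg m <= d)%N -> (mfps_trunc d f)@_m = f m.
Proof. by move=> le_md; rewrite /mfps_trunc mcoeff_mpoly. Qed.

Lemma mcoeff_trunc_mul (p q p' q' : {mpoly R[n]}) m :
  (forall k, (mdeg k <= mdeg m)%N -> p@_k = p'@_k) ->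
  (forall k, (mdeg k <= mdeg m)%N -> q@_k = q'@_k) ->
  (p * q)@_m = (p' * q')@_m.
Proof.
move=> pp' qq'; rewrite !mcoeffM; apply: eq_bigr => k _.
by rewrite pp' ?qq' // -ltnS bmdeg.
Qed.

Lemma mfps_mulE d f g m : (mdeg m <= d)%N ->
  mfps_mul f g m = (mfps_trunc d f * mfps_trunc d g)@_m.
Proof.
move=> le_md; rewrite mcoeffM /=; apply: eq_bigr => k _.
by rewrite !mcoeff_mfps_trunc // (leq_trans _ le_md) // -ltnS bmdeg.
Qed.

Fact mfps_mulA : associative mfps_mul.
Proof.
move=> f g h; apply: mfpsP => m; rewrite !(mfps_mulE _ _ (leqnn _)).
set t := mfps_trunc (mdeg m).
transitivity ((t f * (t g * t h))@_m).
  apply: mcoeff_trunc_mul => // k le_k.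
  by rewrite mcoeff_mfps_trunc // (mfps_mulE _ _ le_k).
rewrite mulrA; apply: mcoeff_trunc_mul => // k le_k.
by rewrite mcoeff_mfps_trunc // (mfps_mulE _ _ le_k).
Qed.

Fact mfps_mulC : commutative mfps_mul.
Proof.
by move=> f g; apply: mfpsP => m; rewrite !(mfps_mulE _ _ (leqnn _)) mulrC.
Qed.

Fact mfps_mul1 : left_id mfps1 mfps_mul.
Proof.
move=> f; apply: mfpsP => m; rewrite (mfps_mulE _ _ (leqnn _)).
rewrite -[RHS](mcoeff_mfps_trunc f (leqnn (mdeg m))).
rewrite -[mfps_trunc _ f in RHS]mul1r; apply: mcoeff_trunc_mul => // k le_k.
by rewrite mcoeff_mfps_trunc // mcoeff1.
Qed.

Fact mfps_mulDl : left_distributive mfps_mul mfps_add.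
Proof.
move=> f g h; apply: mfpsP => m /=.
by rewrite -big_split; apply: eq_bigr => k _; rewrite mulrDl.
Qed.

Fact mfps_1neq0 : mfps1 != 0.
Proof.
apply/eqP => /(congr1 (fun f : mfps n R => f 0%MM)) /= /eqP.
by rewrite eqxx oner_eq0.
Qed.

HB.instance Definition _ := GRing.Zmodule_isComNzRing.Build (mfps n R)
  mfps_mulA mfps_mulC mfps_mul1 mfps_mulDl mfps_1neq0.

Lemma mfps_coef0 m : (0 : mfps n R) m = 0. Proof. by []. Qed.
Lemma mfps_coef1 m : (1 : mfps n R) m = (m == 0%MM)%:R. Proof. by []. Qed.
Lemma mfps_coefD f g m : (f + g) m = f m + g m. Proof. by []. Qed.
Lemma mfps_coefN f m : (- f) m = - f m. Proof. by []. Qed.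
Lemma mfps_coefB f g m : (f - g) m = f m - g m. Proof. by []. Qed.
Lemma mfps_coefM f g m : (f * g) m =
  \sum_(k : 'X_{1..n < (mdeg m).+1, (mdeg m).+1} | m == (k.1 + k.2)%MM)
    f k.1 * g k.2.
Proof. by []. Qed.
Lemma mfps_coef_sum (I : Type) (s : seq I) (P : pred I) (F : I -> mfps n R) m :
  (\sum_(i <- s | P i) F i) m = \sum_(i <- s | P i) F i m.
Proof. exact: (big_morph (fun f : mfps n R => f m)). Qed.

Definition mfpsC (c : R) : mfps n R := MFps (fun m => c *+ (m == 0%MM)).

Definition mfpsX (i : 'I_n) : mfps n R := MFps (fun m => (m == U_(i)%MM)%:R).

Lemma mfps_coefM0 f g : (f * g) 0%MM = f 0%MM * g 0%MM.
Proof.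
by rewrite [LHS](mfps_mulE _ _ (leqnn _)) rmorphM /= !mcoeff_mfps_trunc.
Qed.

Lemma mfps_coefX_small f k m : f 0%MM = 0 -> (mdeg m < k)%N -> (f ^+ k) m = 0.
Proof.
move=> f0; elim: k m => // k IHk m lt_mk; rewrite exprS mfps_coefM big1 // => p.
case: (eqVneq (p.1 : 'X_{1..n}) 0%MM) => [-> _|p1_neq0 /eqP def_m].
  by rewrite f0 mul0r.
have def_dm := congr1 mdeg def_m; rewrite mdegD in def_dm.
rewrite IHk ?mulr0 //; move: lt_mk; rewrite [X in (X < _)%N]def_dm ltnS.
by apply: leq_trans; rewrite -addn1 addnC leq_add2r lt0n mdeg_eq0.
Qed.

Lemma mfps_eq_coefM f f' g m :
  (forall k, (mdeg k <= mdeg m)%N -> f k = f' k) -> (g * f) m = (g * f') m.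
Proof.
move=> ff'; rewrite !mfps_coefM; apply: eq_bigr => k _.
by rewrite ff' // -ltnS bmdeg.
Qed.

End MfpsRing.

Section MfpsUnitRing.
Variables (n : nat) (R : comUnitRingType).
Implicit Types (f g : mfps n R) (m : 'X_{1..n}).

Definition mfps_unit : {pred mfps n R} :=
  [pred f : mfps n R | f 0%MM \is a GRing.unit].

(* With c the constant coefficient of f and h = 1 - c^-1 f, this is the
   geometric series f^-1 = c^-1 (1 + h + h^2 + ...), in which the powers h^k
   with k > mdeg m do not contribute to the coefficient at m. *)
Definition mfps_geom_inv f : mfps n R := MFps (fun m =>
  (f 0%MM)^-1 *
    (\sum_(k < (mdeg m).+1) (1 - mfpsC n (f 0%MM)^-1 * f) ^+ k) m).

Definition mfps_inv f := if f \in mfps_unit then mfps_geom_inv f else f.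

Lemma mfps_coefCM c f m : (mfpsC n c * f) m = c * f m.
Proof.
rewrite mfps_coefM.
have h0 : (mdeg (0%MM : 'X_{1..n}) < (mdeg m).+1)%N by rewrite mdeg0.
rewrite (bigD1 (BMultinom h0, BMultinom (leqnn (mdeg m).+1))) ?add0m //=.
rewrite eqxx mulr1n big1 ?addr0 // => -[p q] /= /andP[/eqP def_m neq].
case: eqVneq => [p0|_]; last by rewrite mulr0n mul0r.
case/eqP: neq; congr (_, _); apply: val_inj => //=.
by rewrite [RHS]def_m p0 add0m.
Qed.

Fact mfps_mulV : {in mfps_unit, left_inverse 1 mfps_inv *%R}.
Proof.
move=> f fU; rewrite /mfps_inv fU mulrC; move: fU; rewrite inE => fU.
set c := f 0%MM in fU *; set h := 1 - mfpsC n c^-1 * f.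
have h0 : h 0%MM = 0.
  by rewrite mfps_coefB mfps_coefCM mfps_coef1 eqxx -/c mulVr ?subrr.
apply: mfpsP => m.
transitivity ((f * (mfpsC n c^-1 * \sum_(k < (mdeg m).+1) h ^+ k)) m).
  apply: mfps_eq_coefM => k le_km; rewrite mfps_coefCM /= -/c -/h; congr (_ * _).
  rewrite !mfps_coef_sum -(subnKC le_km) -addSn big_split_ord /=.
  rewrite [X in _ + X]big1 ?addr0 // => i _.
  by rewrite mfps_coefX_small // ltn_addr.
have -> : f * (mfpsC n c^-1 * \sum_(k < (mdeg m).+1) h ^+ k)
          = 1 - h ^+ (mdeg m).+1.
  rewrite mulrCA mulrA -opprB subrX1 -mulNr.
  by rewrite /h opprB opprD opprK addrA subrr add0r.
by rewrite mfps_coefB mfps_coefX_small // subr0.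
Qed.

Fact mfps_unitP f g : g * f = 1 -> f \in mfps_unit.
Proof.
move=> /(congr1 (fun h : mfps n R => h 0%MM)).
rewrite mfps_coefM0 mfps_coef1 eqxx inE => gf1.
by apply/unitrP; exists (g 0%MM); split; rewrite // mulrC.
Qed.

Fact mfps_inv_out : {in [predC mfps_unit], mfps_inv =1 id}.
Proof. by move=> f; rewrite inE /= /mfps_inv => /negbTE ->. Qed.

HB.instance Definition _ := GRing.ComNzRing_hasMulInverse.Build (mfps n R)
  mfps_mulV mfps_unitP mfps_inv_out.

Lemma mfps_unitE f :
  (f \is a GRing.unit) = (f 0%MM \is a GRing.unit).
Proof. by []. Qed.

End MfpsUnitRing.

(* Convergence to S of the series of the F k, for the usual topology of
   R[[X]]: every coefficient of the partial sums is eventually equal to that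
   of S. *)
Definition mfps_has_sum (n : nat) (R : comNzRingType) (F : nat -> mfps n R)
    (S : mfps n R) : Prop :=
  forall m : 'X_{1..n}, exists K0 : nat, forall K : nat, (K0 <= K)%N ->
    (\sum_(k < K) F k) m = S m.

Lemma mfps_has_sum_unique (n : nat) (R : comNzRingType) (F : nat -> mfps n R)
    (S T : mfps n R) : mfps_has_sum F S -> mfps_has_sum F T -> S = T.
Proof.
move=> FS FT; apply: mfpsP => m; have [K KS] := FS m; have [L LT] := FT m.
by rewrite -(KS _ (leq_maxl K L)) (LT _ (leq_maxr K L)).
Qed.

(** * Descents and color changes

    'I_n stands for {1, ..., n} with indices shifted by one, so that the
    ordinal j stands for the position (or the value) j + 1. *)

Definition qint (A : pzRingType) (m : nat) (z : A) : A := \sum_(i < m) z ^+ i.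

Definition Des (n : nat) (p : 'S_n) : {set 'I_n} :=
  [set j : 'I_n | [exists k : 'I_n, (k == j.+1 :> nat) && (p k < p j)%N]].

(* The element (p, e) with e = (w ^ c_1, ..., w ^ c_n), w = exp (2 i pi / r),
   is represented by p and by the exponents c_j in {0, ..., r - 1}. *)
Definition wreath (r n : nat) : finType := ('S_n * {ffun 'I_n -> 'I_r})%type.

(* c_(j + 1) for j < n, extended by c_(n + 1) = 0. *)
Definition color (r n : nat) (c : {ffun 'I_n -> 'I_r}) (j : nat) : nat :=
  if insub j is Some i then c i : nat else 0%N.

(* (c_j - c_(j + 1)) mod r; r is added first because subtraction on nat is
   truncated. *)
Definition color_change (r n : nat) (c : {ffun 'I_n -> 'I_r}) (j : 'I_n) : nat :=
  ((color c j + r - color c j.+1) %% r)%N.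

Definition z0 (n : nat) : mfps n.+1 int := mfpsX int ord0.
Definition z_ (n : nat) (i : 'I_n) : mfps n.+1 int := mfpsX int (lift ord0 i).

(* The denominators of the theorem are invertible, so that the division in
   Z[[z_0, ..., z_n]] is meaningful. *)
Lemma denominator_unit (r n : nat) (p : 'S_n) : (0 < r)%N ->
  (1 - z0 n) * \prod_(j < n)
    (1 - z0 n ^+ r * \prod_(i < n | (i <= j)%N) z_ (p i) ^+ r)
  \is a GRing.unit.
Proof.
move=> r_gt0; have z00 : z0 n 0%MM = 0.
  rewrite /z0 /= [_ == _](_ : _ = false) //; apply/negbTE/eqP.
  by move=> /(congr1 mdeg); rewrite mdeg0 mdeg1.
have unit1B (f : mfps n.+1 int) : 1 - z0 n * f \is a GRing.unit.
  by rewrite mfps_unitE mfps_coefB mfps_coefM0 z00 mul0r subr0 mfps_coef1 eqxx.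
rewrite unitrM -[X in 1 - X \is a _]mulr1 unit1B /=.
apply: rpred_prod => j _.
by rewrite -(prednK r_gt0) exprS -[_ * _ * _]mulrA unit1B.
Qed.

(* Main.v *)
Require Import Defs.
From HB Require Import structures.
From mathcomp Require Import all_boot all_order all_algebra.
From mathcomp Require Import fingroup perm.
From mathcomp Require Import mpoly zify.

(** The left-hand side is the sum of the monomials [z_0^k z^m] with
    [m_j <= k] for all [j]. Put [Y_j = z_0 z_(p 1) ... z_(p j)]. The colors [c]
    and their changes [a] determine each other, so for fixed [p] the sum over
    the colors factors, and [1 - Y^r = (1 - Y) (1 + Y + ... + Y^(r - 1))]
    reduces it to [prod_(j in Des p) Y_j / ((1 - z_0) prod_j (1 - Y_j))],
    which does not depend on [r]. The latter is the sum of the monomials with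
    [k >= m_(p 1) >= ... >= m_(p n)], strictly at the descents of [p]: each
    factor [1 - Y_t] turns the inequality on the [t]-th gap into an equality.
    Such a [p] lists the indices by decreasing [m] with ties in increasing
    order, so each [m] bounded by [k] belongs to exactly one [p]. *)

Set Implicit Arguments.
Unset Strict Implicit.
Unset Printing Implicit Defensive.

Import GRing.Theory.
Local Open Scope ring_scope.

(** * Monomials as power series *)

Section Monomials.
Variables (n : nat) (R : comNzRingType).
Implicit Types (f : mfps n R) (a b m : 'X_{1..n}).

Definition mfps_mono a : mfps n R := MFps (fun m => (m == a)%:R).

Lemma mfps_coef_monoM a f m :
  (mfps_mono a * f) m = if (a <= m)%MM then f (m - a)%MM else 0.
Proof.
rewrite mfps_coefM; case: ifPn => [le_am|nle_am]; last first.
  apply: big1 => -[p q] /= /eqP def_m; case: eqP => [pa|_]; last by rewrite mul0r.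
  by case/negP: nle_am; rewrite def_m pa lem_addr.
have ha : (mdeg a < (mdeg m).+1)%N.
  by rewrite ltnS -(submK le_am) mdegD leq_addl.
have hb : (mdeg (m - a)%MM < (mdeg m).+1)%N.
  by rewrite ltnS -{2}(submK le_am) mdegD leq_addr.
rewrite (bigD1 (BMultinom ha, BMultinom hb)) /=; last by rewrite addmC submK.
rewrite eqxx mul1r big1 ?addr0 // => -[p q] /= /andP[/eqP def_m neq].
case: eqP => [pa|_]; last by rewrite mul0r.
case/eqP: neq; congr (_, _); apply: val_inj => //=.
by rewrite [in RHS]def_m pa addmC addmK.
Qed.

Lemma mfps_mono0 : mfps_mono 0%MM = 1. Proof. by []. Qed.

Lemma mfps_monoD a b : mfps_mono (a + b)%MM = mfps_mono a * mfps_mono b.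
Proof.
apply: mfpsP => m; rewrite mfps_coef_monoM /=.
case: ifPn => [le_am|nle_am].
  congr (_%:R); congr nat_of_bool; apply/eqP/eqP => [->|<-].
    by rewrite addmC addmK.
  by rewrite addmC submK.
case: eqP => // def_m; by case/negP: nle_am; rewrite def_m lem_addr.
Qed.

Lemma mfps_mono_sum (I : Type) (s : seq I) (P : pred I) (F : I -> 'X_{1..n}) :
  mfps_mono (\sum_(i <- s | P i) F i)%MM = \prod_(i <- s | P i) mfps_mono (F i).
Proof. exact: (big_morph _ mfps_monoD mfps_mono0). Qed.

Lemma mfps_monoX a k : mfps_mono (a *+ k)%MM = mfps_mono a ^+ k.
Proof.
elim: k => [|k IHk]; first by rewrite mulm0n expr0 mfps_mono0.
by rewrite mulmS mfps_monoD IHk exprS.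
Qed.

End Monomials.

(** * Vectors with prescribed gaps along a permutation, and their generating function *)

Section Chains.
Variables (N : nat) (s : 'S_N) (e : 'I_N -> nat).
Implicit Types (m : 'X_{1..N}).

(** The value 0 past the end makes the last gap equal to the last entry. *)
Definition entry m (j : nat) : nat :=
  if insub j is Some i then m (s i) else 0%N.

Lemma entry_ord m (i : 'I_N) : entry m i = m (s i).
Proof. by rewrite /entry valK. Qed.

Lemma entry_ge m j : (N <= j)%N -> entry m j = 0%N.
Proof. by move=> le_Nj; rewrite /entry insubN // -leqNgt. Qed.

Lemma entry_inj m m' : entry m =1 entry m' -> m = m'.
Proof.
move=> mm'; apply/mnmP => i.
by rewrite -[i](permKV s) -!entry_ord mm'.
Qed.

Lemma entryB m m' j : entry (m - m')%MM j = (entry m j - entry m' j)%N.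
Proof. by rewrite /entry; case: insubP => // i _ _; rewrite mnmBE. Qed.

Lemma lepm_entry m m' :
  (forall j, (entry m j <= entry m' j)%N) <-> (m <= m')%MM.
Proof.
split=> [le_mm'|/mnm_lepP le_mm' j].
  by apply/mnm_lepP => i; rewrite -[i](permKV s) -!entry_ord.
by rewrite /entry; case: insubP.
Qed.

Definition chain_mnm (t : nat) : 'X_{1..N} :=
  (\sum_(i < N | (i <= t)%N) U_(s i))%MM.

Lemma entry_chain_mnm t j : entry (chain_mnm t) j =
  ((j <= t) && (j < N))%N.
Proof.
rewrite /entry; case: insubP => [i lt_jN <-|]; last first.
  by move/negbTE->; rewrite andbF.
rewrite /chain_mnm mnm_sumE ltn_ord andbT.
under eq_bigr do rewrite mnm1E (inj_eq perm_inj).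
case: leqP => [le_it|lt_ti]; last first.
  apply: big1 => k le_kt; case: eqP => // ki.
  by move: le_kt; rewrite ki leqNgt lt_ti.
rewrite (bigD1 i) //= eqxx big1 // => k /andP[_ /negbTE ->] //.
Qed.


(* The gaps [entry m j - entry m j.+1] are the exponents of [m] along the
   monomials [chain_mnm j]; this asks that they are at least [e j] for
   [j >= t] and equal to [e j] for [j < t]. *)
Definition in_chain_cone (t : nat) m : bool :=
  [forall j : 'I_N, if (j < t)%N then (entry m j.+1 + e j == entry m j)%N
                    else (entry m j.+1 + e j <= entry m j)%N].

Lemma in_chain_coneP t m :
  reflect (forall j : 'I_N, (entry m j.+1 + e j <= entry m j)%N /\
             ((j < t)%N -> entry m j = (entry m j.+1 + e j)%N))
          (in_chain_cone t m).
Proof.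
apply: (iffP forallP) => h j; have := h j.
  by case: ifP => [_ /eqP <-|].
by case: ifP => [_ [_ /(_ isT) ->]|_ []].
Qed.

Lemma entry_antitone t m i j : in_chain_cone t m -> (i <= j)%N ->
  (entry m j <= entry m i)%N.
Proof.
move=> /in_chain_coneP h /subnKC <-.
elim: (j - i)%N => [|k IHk]; first by rewrite addn0.
rewrite addnS (leq_trans _ IHk) //; case: (ltnP (i + k)%N N) => [lt_N|le_N].
  by have [+ _] := h (Ordinal lt_N) => /=; lia.
by rewrite entry_ge // ltnW.
Qed.

Definition cone_series (R : comNzRingType) (t : nat) : mfps N R :=
  MFps (fun m => (in_chain_cone t m)%:R).

(** Adding [chain_mnm t] raises the [t]-th gap by 1 and fixes all the others. The subtracted series
    is thus the part of the cone with [t]-th gap above [e t]; what remains has gap exactly [e t]. *)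
Lemma cone_series_step (R : comNzRingType) t : (t < N)%N ->
  cone_series R t * (1 - mfps_mono R (chain_mnm t)) = cone_series R t.+1.
Proof.
move=> lt_tN; apply: mfpsP => m.
rewrite mulrBr mulr1 mfps_coefB [_ * mfps_mono _ _]mulrC mfps_coef_monoM /=.
have chainE j : entry (chain_mnm t) j = (j <= t)%N :> nat.
  rewrite entry_chain_mnm; case: (leqP j t) => // le_jt.
  by rewrite (leq_ltn_trans le_jt).
have stepE : in_chain_cone t.+1 m =
    in_chain_cone t m && (entry m t == entry m t.+1 + e (Ordinal lt_tN))%N.
  apply/in_chain_coneP/andP => [h|[/in_chain_coneP h /eqP ht] j].
    split; last by have [_ /(_ (ltnSn _)) ->] := h (Ordinal lt_tN).
    apply/in_chain_coneP => j; have [h1 h2] := h j.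
    by split=> // lt_jt; apply: h2; apply: ltnW.
  have [h1 h2] := h j; split=> //; rewrite ltnS leq_eqVlt => /orP[/eqP jt|//].
  by rewrite jt ht; congr (_ + e _)%N; apply: val_inj.
case: ifPn => [/lepm_entry le_m|nle_m]; last first.
  (* Nothing is subtracted here. The entries decrease, so [entry m t] is 0, and the [t]-th
     inequality is already an equality. *)
  rewrite subr0 stepE; case: (boolP (in_chain_cone t m)) => //= cm.
  suff m0 : entry m t = 0%N.
    have /in_chain_coneP/(_ (Ordinal lt_tN))[+ _] := cm.
    by rewrite /= m0 leqn0 eq_sym => ->.
  apply/eqP; apply: contraNT nle_m; rewrite -lt0n => mt.
  apply/lepm_entry => j; rewrite chainE; case: (leqP j t) => // le_jt.
  exact: leq_trans mt (entry_antitone cm le_jt).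
have stepE' : in_chain_cone t (m - chain_mnm t)%MM =
    in_chain_cone t m && (entry m t != entry m t.+1 + e (Ordinal lt_tN))%N.
  have BE j : entry (m - chain_mnm t)%MM j = (entry m j - (j <= t))%N.
    by rewrite entryB chainE.
  have le_m' j : ((j <= t)%N <= entry m j)%N by rewrite -chainE.
  apply/in_chain_coneP/andP => [h|[/in_chain_coneP h /eqP ht] j].
    split.
      apply/in_chain_coneP => j; have := h j; rewrite !BE.
      have := le_m' j; have := le_m' j.+1; lia.
    have [+ _] := h (Ordinal lt_tN); rewrite !BE /=.
    have := le_m' t; lia.
  have := h j; rewrite !BE.
  have := le_m' j; have := le_m' j.+1.
  have [jt|jt] := eqVneq (j : nat) t; last by lia.
  have -> : j = Ordinal lt_tN by apply: val_inj.
  by rewrite /=; lia.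
rewrite stepE stepE'; case: (in_chain_cone t m); case: eqP => _;
  by rewrite /= ?subrr ?subr0.
Qed.

(** Once all gaps are fixed, a single vector is left: the sum of the [chain_mnm j] with
    multiplicities [e j]. *)
Lemma cone_seriesN (R : comNzRingType) :
  cone_series R N = \prod_(j < N) mfps_mono R (chain_mnm j) ^+ e j.
Proof.
under eq_bigr do rewrite -mfps_monoX.
rewrite -mfps_mono_sum; apply: mfpsP => m /=; congr (_%:R); congr nat_of_bool.
set a := (\sum_(_ < N | _) _)%MM.
have aE j : entry a j = (\sum_(i < N | (j <= i)%N) e i)%N.
  rewrite /entry; case: insubP => [k _ <-|]; last first.
    by rewrite -leqNgt => le_Nj; rewrite big1 // => i; have := ltn_ord i; lia.
  rewrite mnm_sumE [RHS]big_mkcond /=; apply: eq_bigr => i _.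
  rewrite mulmnE -entry_ord entry_chain_mnm ltn_ord andbT.
  by case: leqP; rewrite ?mul1n.
apply/in_chain_coneP/eqP => [h|-> j]; last first.
  have Ea : entry a j = (entry a j.+1 + e j)%N.
    by rewrite !aE (bigD1 j) //= addnC; congr (_ + _)%N; apply: eq_bigl => i;
       rewrite ltn_neqAle andbC eq_sym.
  by rewrite Ea.
(* Downward induction on [j], starting past the end, where both entries are 0. *)
apply: entry_inj => j; move: {2}(N - j)%N (erefl (N - j)%N) => d.
elim: d j => [|d IHd] j Ej.
  have le_Nj : (N <= j)%N by rewrite -subn_eq0 Ej.
  by rewrite !entry_ge.
have lt_jN : (j < N)%N by rewrite -subn_gt0 Ej.
have [_ /(_ lt_jN) /= ->] := h (Ordinal lt_jN).
rewrite IHd; last by lia.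
rewrite !aE [RHS](bigD1 (Ordinal lt_jN)) //= addnC; congr (_ + _)%N.
by apply: eq_bigl => i; rewrite ltn_neqAle andbC eq_sym.
Qed.

Lemma cone_series_prod (R : comNzRingType) :
  cone_series R 0 * \prod_(j < N) (1 - mfps_mono R (chain_mnm j)) =
  \prod_(j < N) mfps_mono R (chain_mnm j) ^+ e j.
Proof.
rewrite -cone_seriesN.
suff main t : (t <= N)%N -> cone_series R 0 *
    \prod_(j < t) (1 - mfps_mono R (chain_mnm j)) = cone_series R t.
  exact: main.
elim: t => [|t IHt] le_tN; first by rewrite big_ord0 mulr1.
by rewrite big_ord_recr mulrA IHt ?(ltnW le_tN) //= cone_series_step.
Qed.

End Chains.

Section SortingPermutation.
Variables (n : nat) (v : 'I_n -> nat).

(** Breaking ties by index makes this a total order, so that only one listing is sorted. *)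
Definition stable_le : rel 'I_n :=
  fun a b => (v b < v a)%N || (v a == v b) && (a <= b)%N.

Lemma stable_le_trans : transitive stable_le.
Proof. by move=> b a c; rewrite /stable_le; lia. Qed.

Lemma stable_le_anti : antisymmetric stable_le.
Proof. by move=> a b; rewrite /stable_le => h; apply: val_inj => /=; lia. Qed.

Lemma stable_le_total : total stable_le.
Proof. by move=> a b; rewrite /stable_le; lia. Qed.

Definition sorts (p : 'S_n) : bool :=
  [forall j : 'I_n, forall k : 'I_n,
     (k == j.+1 :> nat) ==> (v (p k) + (j \in Des p) <= v (p j))%N].

Lemma Des_succ (p : 'S_n) (j k : 'I_n) : k = j.+1 :> nat ->
  (j \in Des p) = (p k < p j)%N.
Proof.
move=> kj; rewrite inE; apply/existsP/idP => [[i /andP[/eqP ij]]|lt_p].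
  by have -> : i = k by apply: val_inj; rewrite /= ij kj.
by exists k; rewrite kj eqxx.
Qed.

(** For consecutive values, a tie in [v] is allowed by [sorts] exactly at an ascent of [p], which is
    the tie-breaking rule of [stable_le]. *)
Lemma sortsE (p : 'S_n) : sorts p = sorted stable_le (codom p).
Proof.
have nthE i0 (i : 'I_n) : nth i0 (codom p) i = p i.
  by rewrite (nth_map i0) ?size_enum_ord // nth_ord_enum.
have step (j k : 'I_n) : k = j.+1 :> nat ->
    (v (p k) + (j \in Des p) <= v (p j))%N = stable_le (p j) (p k).
  move=> kj; rewrite (Des_succ p kj) /stable_le.
  have : (p k != p j :> nat).
    by rewrite !(inj_eq val_inj, inj_eq perm_inj) -val_eqE /= kj; lia.
  by case: (ltngtP (p k) (p j)); lia.
apply/idP/idP => [/forallP h|].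
  case defc: (codom p) => [//|x0 l]; rewrite -defc.
  apply/(sortedP x0) => i; rewrite size_codom card_ord => lt_i.
  rewrite -[i.+1]/(nat_of_ord (Ordinal lt_i)).
  rewrite -[X in nth _ _ X]/(nat_of_ord (Ordinal (ltnW lt_i))).
  rewrite !nthE -step //.
  by have /forallP/(_ (Ordinal lt_i))/implyP := h (Ordinal (ltnW lt_i)); apply.
move=> h; apply/forallP => j; apply/forallP => k; apply/implyP => /eqP kj.
rewrite step // -!(nthE j) kj.
by apply: (sortedP j h); rewrite -kj size_codom card_ord.
Qed.

(** Sorting the enumeration gives one such [p]; two sorted lists with the same elements coincide.
    The form as a sum is that of a coefficient of the sum of the cone series over [p]. *)
Lemma sorts_unique : (\sum_(p : 'S_n) sorts p)%N = 1%N.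
Proof.
have perm_enum (p : 'S_n) : perm_eq (codom p) (enum 'I_n).
  apply: uniq_perm; rewrite ?enum_uniq //.
    by apply/injectiveP; apply: perm_inj.
  by move=> i; rewrite mem_enum inE -[i](permKV p) codom_f.
have [p defp] : exists p : 'S_n, sort stable_le (enum 'I_n) = codom p.
  have /tuple_permP[p] : perm_eq (sort stable_le (enum 'I_n)) (ord_tuple n).
    by rewrite perm_sort val_ord_tuple.
  move=> ->; exists p; rewrite /= codomE.
  by apply: eq_map => i; rewrite tnth_ord_tuple.
have sp : sorts p.
  by rewrite sortsE -defp sort_sorted //; exact: stable_le_total.
rewrite (bigD1 p) //= sp big1 // => q neq; apply/eqP; rewrite eqb0.
apply: contraNN neq; rewrite !sortsE in sp * => sq; apply/eqP/permP => i.
have Epq : codom q = codom p.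
  apply: (sorted_eq stable_le_trans stable_le_anti) => //.
  by rewrite (permPl (perm_enum q)) perm_sym.
have nthE (p' : 'S_n) : nth i (codom p') i = p' i.
  by rewrite (nth_map i) ?size_enum_ord // nth_ord_enum.
by rewrite -!nthE Epq.
Qed.

End SortingPermutation.

(** * Color changes and the sum over the colors *)

Section ColorChange.
Variables (r n : nat).
Implicit Types (c : {ffun 'I_n -> 'I_r}).

Lemma color_ord c (i : 'I_n) : color c i = c i.
Proof. by rewrite /color valK. Qed.

Lemma color_ge c j : (n <= j)%N -> color c j = 0%N.
Proof. by move=> le_nj; rewrite /color insubN // -leqNgt. Qed.

Lemma color_change_lt c j : (color_change c j < r)%N.
Proof. by rewrite ltn_pmod // (leq_ltn_trans _ (ltn_ord (c j))). Qed.

Definition color_changes c : {ffun 'I_n -> 'I_r} :=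
  [ffun j => Ordinal (color_change_lt c j)].

(** The colors are recovered from right to left, starting from the color 0 past the end. As source
    and target are the same finite type, this permits reindexing by the changes. *)
Lemma color_changes_inj : injective color_changes.
Proof.
move=> c c' /ffunP eq_cc'.
suff main j : color c j = color c' j.
  by apply/ffunP => j; apply: val_inj; rewrite /= -!color_ord.
move: {2}(n - j)%N (erefl (n - j)%N) => d; elim: d j => [|d IHd] j Ej.
  have le_nj : (n <= j)%N by rewrite -subn_eq0 Ej.
  by rewrite !color_ge.
have lt_jn : (j < n)%N by rewrite -subn_gt0 Ej.
have /(congr1 val) := eq_cc' (Ordinal lt_jn); rewrite !ffunE /= /color_change /=.
rewrite (IHd j.+1); last by lia.
have lt_c (b : {ffun 'I_n -> 'I_r}) k : (color b k < r)%N.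
  rewrite /color; case: insubP => // _.
  exact: leq_ltn_trans (leq0n _) (ltn_ord (b (Ordinal lt_jn))).
have := lt_c c j; have := lt_c c' j; have := lt_c c' j.+1.
move: (color c j) (color c' j) (color c' j.+1) => x y z lt_z lt_y lt_x E.
have [r_gt0 lt_zr] : (0 < r)%N /\ (z <= r)%N by lia.
(* Adding back the common next color [z] cancels the truncated subtraction, since [z <= r]. *)
have : (x + r - z + z = y + r - z + z %[mod r])%N.
  by rewrite -(modnDml (x + _ - _)) E modnDml.
by rewrite !subnK ?modnDr ?modn_small //; lia.
Qed.

End ColorChange.

Lemma subr1X_qint (A : pzRingType) (r : nat) (y : A) :
  1 - y ^+ r = (1 - y) * qint r y.
Proof. by rewrite -opprB subrX1 -mulNr opprB. Qed.

Section ColorSum.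
Variables (A : comPzRingType) (r n : nat).

(** The left side is [y + ... + y ^+ r]; its top term is matched with [a = 0]. This is the extra
    factor at a descent without color change. *)
Lemma mul_qint (y : A) : (0 < r)%N ->
  y * qint r y = \sum_(a < r) (if a == 0%N :> nat then y ^+ r else 1) * y ^+ a.
Proof.
rewrite /qint; case: r => // k _.
rewrite big_ord_recr [in RHS]big_ord_recl /= mulrDr mulr1 -exprS addrC.
by rewrite mulr_sumr; congr (_ + _); apply: eq_bigr => i _; rewrite mul1r exprS.
Qed.

(** The changes range independently over all functions, so the sum of products is a product of sums
    over a single change. *)
Lemma sum_color_changes (D : {set 'I_n}) (Y : 'I_n -> A) : (0 < r)%N ->
  \sum_(c : {ffun 'I_n -> 'I_r})
     (\prod_(j in D | color_change c j == 0%N) Y j ^+ r) *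
     \prod_(j < n) Y j ^+ color_change c j
  = \prod_(j < n) (Y j ^+ (j \in D) * qint r (Y j)).
Proof.
move=> r_gt0; pose F j (a : 'I_r) :=
  (if (j \in D) && (a == 0%N :> nat) then Y j ^+ r else 1) * Y j ^+ a.
transitivity (\prod_(j < n) \sum_(a < r) F j a); last first.
  apply: eq_bigr => j _; rewrite /F; case: (j \in D) => /=.
    by rewrite expr1 mul_qint.
  by rewrite expr0 mul1r; apply: eq_bigr => a _; rewrite mul1r.
rewrite bigA_distr_bigA [RHS](reindex_inj (@color_changes_inj r n)) /=.
apply: eq_bigr => c _; rewrite /F big_split /=; congr (_ * _).
  by rewrite big_mkcond /=; apply: eq_bigr => j _; rewrite ffunE.
by apply: eq_bigr => j _; rewrite ffunE.
Qed.

End ColorSum.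

(** * Both sides as the sum of the bounded monomials *)

Section MainIdentity.
Variable n : nat.
Implicit Types (m : 'X_{1..n.+1}) (p : 'S_n).

Definition bounded_by0 m : bool :=
  [forall j : 'I_n, (m (lift ord0 j) <= m ord0)%N].

(** Fixing 0 puts the exponent [k] of [z0] at the head of each chain. *)
Definition lift_perm0 p : 'S_n.+1 := lift_perm ord0 ord0 p.

Definition des_exp p (i : 'I_n.+1) : nat :=
  if unlift ord0 i is Some j then j \in Des p else 0%N.

Lemma entry_lift p m (i : 'I_n) :
  entry (lift_perm0 p) m i.+1 = m (lift ord0 (p i)).
Proof.
rewrite -[i.+1]/(nat_of_ord (lift ord0 i)) entry_ord.
by rewrite /lift_perm0 lift_perm_lift.
Qed.

Lemma entry_zero p m : entry (lift_perm0 p) m 0 = m ord0.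
Proof.
by rewrite -[0%N]/(nat_of_ord (@ord0 n)) entry_ord /lift_perm0 lift_perm_id.
Qed.

Lemma in_chain_cone_sorts p m :
  in_chain_cone (lift_perm0 p) (des_exp p) 0 m =
  bounded_by0 m && sorts (fun i => m (lift ord0 i)) p.
Proof.
apply/idP/andP => [h|[/forallP hb /forallP hs]].
  split.
    apply/forallP => j; rewrite -[j](permKV p) -entry_lift -(entry_zero p).
    exact: entry_antitone h _.
  apply/forallP => j; apply/forallP => k; apply/implyP => /eqP kj.
  have [+ _] := in_chain_coneP _ _ _ _ h (lift ord0 j).
  by rewrite /des_exp liftK /= /bump /= add1n -{1}kj !entry_lift.
apply/in_chain_coneP => i; split=> //; rewrite /des_exp.
case: unliftP => [j|] -> /=; last first.
  rewrite addn0 entry_zero; case: (ltnP 0 n) => [n_gt0|n_le0].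
    by rewrite (entry_lift p m (Ordinal n_gt0)).
  by rewrite entry_ge.
rewrite /bump /= add1n (entry_lift p m j); case: (ltnP j.+1 n) => [lt_jn|le_nj].
  rewrite (entry_lift p m (Ordinal lt_jn)).
  by have /forallP/(_ (Ordinal lt_jn))/implyP := hs j; apply.
(* The last position has no successor, so it is not a descent. *)
rewrite entry_ge // add0n inE; case: existsP => // -[k /andP[/eqP kj]].
by have := ltn_ord k; rewrite kj ltnNge le_nj.
Qed.

Lemma sum_cone_series :
  \sum_(p : 'S_n) cone_series (lift_perm0 p) (des_exp p) int 0 =
  MFps (fun m => (bounded_by0 m)%:R).
Proof.
apply: mfpsP => m; rewrite mfps_coef_sum /=.
under eq_bigr do rewrite in_chain_cone_sorts.
case: (bounded_by0 m) => /=; last by rewrite big1.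
by rewrite -natr_sum sorts_unique.
Qed.

Definition chain_z p (j : 'I_n) : mfps n.+1 int :=
  z0 n * \prod_(i < n | (i <= j)%N) z_ (p i).

Lemma chain_z_mono p j :
  mfps_mono int (chain_mnm (lift_perm0 p) (lift ord0 j)) = chain_z p j.
Proof.
rewrite /chain_mnm mfps_mono_sum big_mkcond big_ord_recl /=.
rewrite /lift_perm0 lift_perm_id; congr (_ * _).
rewrite [RHS]big_mkcond; apply: eq_bigr => i _.
by rewrite lift_perm_lift /= /bump /= !add1n ltnS.
Qed.

Lemma z0_mono p : mfps_mono int (chain_mnm (lift_perm0 p) 0) = z0 n.
Proof.
rewrite /chain_mnm mfps_mono_sum big_mkcond big_ord_recl /=.
by rewrite /lift_perm0 lift_perm_id big1 ?mulr1 // => i _.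
Qed.

Lemma cone_series_chain_z p :
  cone_series (lift_perm0 p) (des_exp p) int 0 *
    ((1 - z0 n) * \prod_(j < n) (1 - chain_z p j)) =
  \prod_(j < n) chain_z p j ^+ (j \in Des p).
Proof.
have := cone_series_prod (lift_perm0 p) (des_exp p) int.
rewrite !big_ord_recl /= z0_mono {2}/des_exp unlift_none expr0 mul1r => E.
transitivity (\prod_(j < n) mfps_mono int (chain_mnm (lift_perm0 p)
  (lift ord0 j)) ^+ des_exp p (lift ord0 j)).
  by rewrite -E; congr (_ * (_ * _)); apply: eq_bigr => j _; rewrite chain_z_mono.
by apply: eq_bigr => j _; rewrite chain_z_mono /des_exp liftK.
Qed.

(** Expanding the product gives one monomial for each choice [f] of exponents at most [k], and
    distinct choices give distinct monomials. *)
Lemma coef_qint_prod k m :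
  ((\prod_(j < n) qint k.+1 (z_ j)) * z0 n ^+ k) m =
  ((m ord0 == k) && bounded_by0 m)%:R.
Proof.
pose a (f : {ffun 'I_n -> 'I_k.+1}) : 'X_{1..n.+1} :=
  (\sum_(j < n) U_(lift ord0 j) *+ f j + U_(ord0) *+ k)%MM.
have aE (f : {ffun 'I_n -> 'I_k.+1}) :
    (\prod_(j < n) z_ j ^+ f j) * z0 n ^+ k = mfps_mono int (a f).
  rewrite /a mfps_monoD mfps_monoX mfps_mono_sum; congr (_ * _).
  by apply: eq_bigr => j _; rewrite mfps_monoX.
have a0 f : a f ord0 = k.
  rewrite /a mnmDE mulmnE mnm1E eqxx mul1n mnm_sumE big1 // => j _.
  by rewrite mulmnE mnm1E eq_sym (negbTE (neq_lift _ _)).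
have aL f j : a f (lift ord0 j) = f j.
  rewrite /a mnmDE mulmnE mnm1E (negbTE (neq_lift _ _)) mul0n addn0 mnm_sumE.
  rewrite (bigD1 j) //= mulmnE mnm1E eqxx mul1n big1 ?addn0 // => i neq_ij.
  by rewrite mulmnE mnm1E (inj_eq lift_inj) (negbTE neq_ij).
rewrite /qint bigA_distr_bigA mulr_suml mfps_coef_sum.
under eq_bigr do rewrite aE.
case: andP => [[/eqP m0 /forallP mb]|nm].
  pose f := [ffun j : 'I_n => inord (m (lift ord0 j)) : 'I_k.+1].
  have fE j : f j = m (lift ord0 j) :> nat.
    by rewrite ffunE inordK // ltnS -m0.
  have mf : m = a f.
    apply/mnmP => i; case: (unliftP ord0 i) => [j|] ->; first by rewrite aL fE.
    by rewrite a0.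
  rewrite (bigD1 f) //= mf eqxx big1 ?addr0 // => g neq_gf.
  case: eqP => // /mnmP E; case/eqP: neq_gf; apply/ffunP => j; apply: val_inj.
  by have /= := E (lift ord0 j); rewrite !aL.
rewrite big1 // => f _ /=; case: eqP => // mf; case: nm; rewrite mf a0 eqxx.
by split=> //; apply/forallP => j; rewrite aL a0 -ltnS.
Qed.

Lemma has_sum_bounded_by0 : mfps_has_sum
  (fun k : nat => (\prod_(j < n) qint k.+1 (z_ j)) * z0 n ^+ k)
  (MFps (fun m => (bounded_by0 m)%:R)).
Proof.
(* Only the term of index [m ord0] has a nonzero coefficient at [m], if any does. *)
move=> m; exists (m ord0).+1 => K lt_mK; rewrite mfps_coef_sum.
under eq_bigr do rewrite coef_qint_prod.
rewrite (bigD1 (Ordinal lt_mK)) //= eqxx big1 ?addr0 // => k neq.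
by rewrite eq_sym -[m ord0]/(val (Ordinal lt_mK)) val_eqE (negbTE neq).
Qed.

End MainIdentity.

Theorem theorem5p15 (r n : nat) (hr : (0 < r)%N) (hn : (0 < n)%N) :
  mfps_has_sum
    (fun k : nat => (\prod_(j < n) qint k.+1 (z_ j)) * z0 n ^+ k)
    (\sum_(w : wreath r n)
       ((\prod_(j in Des w.1 | color_change w.2 j == 0%N)
            (z0 n ^+ r * \prod_(i < n | (i <= j)%N) z_ (w.1 i) ^+ r))
        * (\prod_(j < n)
            (z0 n ^+ color_change w.2 j *
             \prod_(i < n | (i <= j)%N) z_ (w.1 i) ^+ color_change w.2 j)))
       / ((1 - z0 n) *
          \prod_(j < n)
            (1 - z0 n ^+ r * \prod_(i < n | (i <= j)%N) z_ (w.1 i) ^+ r))).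
Proof.
set S := \sum_(w : wreath r n) _.
suff -> : S = MFps (fun m => (bounded_by0 m)%:R) by exact: has_sum_bounded_by0.
have chainX (p : 'S_n) (j : 'I_n) k :
    z0 n ^+ k * \prod_(i < n | (i <= j)%N) z_ (p i) ^+ k = chain_z p j ^+ k.
  by rewrite /chain_z exprMn prodrXl.
rewrite -sum_cone_series /S.
rewrite -(pair_bigA _ (fun (p : 'S_n) (c : {ffun 'I_n -> 'I_r}) =>
  ((\prod_(j in Des p | color_change c j == 0%N)
      (z0 n ^+ r * \prod_(i < n | (i <= j)%N) z_ (p i) ^+ r))
   * (\prod_(j < n)
       (z0 n ^+ color_change c j *
        \prod_(i < n | (i <= j)%N) z_ (p i) ^+ color_change c j)))
  / ((1 - z0 n) * \prod_(j < n)
      (1 - z0 n ^+ r * \prod_(i < n | (i <= j)%N) z_ (p i) ^+ r)))) /=.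
apply: eq_bigr => p _; rewrite -mulr_suml.
(* For fixed [p] the denominator does not depend on the colors; it is cleared, and the numerators
   are summed. *)
apply: (canLR (mulrK (denominator_unit p hr))).
transitivity (\prod_(j < n)
    (chain_z p j ^+ (j \in Des p) * qint r (chain_z p j))).
  rewrite -sum_color_changes //; apply: eq_bigr => c _.
  by congr (_ * _); apply: eq_bigr => j _; rewrite chainX.
(* The factors [qint] turn each [1 - chain_z p j] into the [1 - chain_z p j ^+ r] of the
   denominator. *)
rewrite big_split /= -cone_series_chain_z -!mulrA; congr (_ * (_ * _)).
rewrite -big_split /=; apply: eq_bigr => j _.
by rewrite chainX subr1X_qint.
Qed.
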